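(* Let $\mathbb{X}$ be a reflexive, smooth and strictly convex complex Banach space and let $V$ be a non-surjective isometry on $\mathbb{X}$. Then the following are equivalent: (i) $V(\mathbb{X})$ is right-complemented; (ii) $M_{V^\times}=S_{\mathbb{W}}$ for some subspace $\mathbb{W}$ of $\mathbb{X}^*$; (iii) $\|f_x+f_y\|=\|f_{Vx}+f_{Vy}\|$ for all $x,y\in\mathbb{X}$; (iv) the map $\Phi^{-1}:\mathbb{X}^*\to\mathbb{J}_{\mathbb{X}}(V(\mathbb{X}))$ is linear, where $\Phi:\mathbb{J}_{\mathbb{X}}(V(\mathbb{X}))\to\mathbb{X}^*$, $\Phi(f_{Vx})=V^\times(f_{Vx})=f_x$.
   Context: An isometry on $\mathbb{X}$ is a linear norm-preserving map $\mathbb{X}\to\mathbb{X}$. $V^\times:\mathbb{X}^*\to\mathbb{X}^*$, $V^\times f=f\circ V$, is the Banach adjoint, and $M_{V^\times}=\{f\in S_{\mathbb{X}^*}:\|V^\times f\|=\|V^\times\|\}$; $S_{\mathbb{Z}}$ is the set of unit vectors of $\mathbb{Z}$. Since $\mathbb{X}$ is smooth, each nonzero $x\in\mathbb{X}$ has a unique support functional $f_x\in\mathbb{X}^*$, i.e. $\|f_x\|=\|x\|$, $f_x(x)=\|x\|^2$; $f_{\mathbf 0}=\mathbf 0$. The duality map is $\mathbb{J}_{\mathbb{X}}(x)=f_x$, and $\mathbb{J}_{\mathbb{X}}(V(\mathbb{X}))=\{f_{Vx}:x\in\mathbb{X}\}\subseteq\mathbb{X}^*$. The map $\Phi$ (restriction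 of $V^\times$ to $\mathbb{J}_{\mathbb{X}}(V(\mathbb{X}))$) is a bijection onto $\mathbb{X}^*$, with $\Phi^{-1}(f_x)=f_{Vx}$; its linearity is understood as that of a map into $\mathbb{X}^*$. $x\perp_B y$ means $\|x+\lambda y\|\ge\|x\|$ for all $\lambda\in\mathbb{C}$; for subspaces it is required for all pairs of elements. A closed subspace $\mathbb{Y}$ is right-complemented if it has a closed vector space complement $\widetilde{\mathbb{Y}}$ with $\mathbb{Y}\perp_B\widetilde{\mathbb{Y}}$. *)

(* Defs.v *)
From HB Require Import structures.
From mathcomp Require Import all_boot all_order all_algebra.
From mathcomp Require Import complex.
From mathcomp Require Import all_classical all_reals all_analysis.

Set Implicit Arguments.
Unset Strict Implicit.
Unset Printing Implicit Defensive.

Import Order.TTheory GRing.Theory Num.Theory.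
Import numFieldNormedType.Exports.

Local Open Scope classical_set_scope.
Local Open Scope ring_scope.
Local Open Scope complex_scope.

Section ContinuousLinear.
Variables (R : realType) (U W : normedModType R[i]).

Definition is_clinear : {pred U -> W} :=
  [pred f | `[< linear f /\ continuous f >]].

Record clinear := CLinear {
  clinear_fun :> U -> W;
  clinear_subproof : clinear_fun \in is_clinear }.

HB.instance Definition _ := [isSub for clinear_fun].
HB.instance Definition _ := [Choice of clinear by <:].

Lemma clinear_continuous (f : clinear) : continuous f.
Proof. by have /asboolP[] := clinear_subproof f. Qed.

Lemma clinear_is_linear (f : clinear) : linear f.
Proof. by have /asboolP[] := clinear_subproof f. Qed.

HB.instance Definition _ (f : clinear) :=
  GRing.isLinear.Build _ _ _ _ f (clinear_is_linear f).

Lemma is_clinear_submod_closed : submod_closed is_clinear.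
Proof.
split.
  rewrite inE; split; first by move=> a x y /=; rewrite scaler0 addr0.
  exact: cst_continuous.
move=> a f g /asboolP[lf cf] /asboolP[lg cg]; rewrite inE; split.
  move=> b x y; rewrite !fctE lf lg !scalerDr !scalerA mulrC.
  by rewrite !addrA [in RHS](addrAC _ (b *: g x)).
by move=> x; apply: cvgD; [apply: cvgZr; exact: cf|exact: cg].
Qed.

HB.instance Definition _ :=
  GRing.isSubmodClosed.Build _ _ is_clinear is_clinear_submod_closed.
HB.instance Definition _ := [SubChoice_isSubLmodule of clinear by <:].

(* Norms of a [normedModType R[i]] are nonnegative real elements of [R[i]], so
   the supremum is taken in [R] and injected back. *)
Definition opnorm (f : clinear) : R[i] :=
  (sup [set complex.Re `|f x| | x in [set x : U | `|x| <= 1]])%:C.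

Lemma Re_normK (V : normedModType R[i]) (x : V) : (complex.Re `|x|)%:C = `|x|.
Proof. by rewrite RRe_real// normr_real. Qed.

Lemma opnorm_has_sup (f : clinear) :
  has_sup [set complex.Re `|f x| | x in [set x : U | `|x| <= 1]].
Proof.
split; first by exists (complex.Re `|f 0|), 0 => //=; rewrite normr0.
have /linear_bounded_continuous/bounded_funP/(_ 1)[M hM] :=
  @clinear_continuous f.
exists (complex.Re M) => _ [x /= /hM + <-].
by rewrite lecE => /andP[].
Qed.

Lemma opnorm_ub (f : clinear) x : `|x| <= 1 -> `|f x| <= opnorm f.
Proof.
move=> x1; rewrite -Re_normK lecR; apply: ub_le_sup; last by exists x.
by have [] := opnorm_has_sup f.
Qed.

Lemma opnorm_le (f : clinear) M :
  (forall x, `|x| <= 1 -> `|f x| <= M) -> opnorm f <= M.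
Proof.
move=> hM.
have M0 : 0 <= M by rewrite (le_trans _ (hM 0 _)) ?normr0.
rewrite -(RRe_real (ger0_real M0)) lecR.
apply: ge_sup; first by have [] := opnorm_has_sup f.
by move=> _ [x /= /hM + <-]; rewrite lecE => /andP[].
Qed.

Lemma opnorm_ge0 (f : clinear) : 0 <= opnorm f.
Proof. by rewrite (le_trans _ (opnorm_ub f (x := 0) _)) ?normr0. Qed.

Lemma le_opnorm (f : clinear) x : `|f x| <= opnorm f * `|x|.
Proof.
have [->|x0] := eqVneq x 0; first by rewrite linear0 !normr0 mulr0.
rewrite -ler_pdivrMr ?normr_gt0// mulrC.
have -> : `|x|^-1 * `|f x| = `|f (`|x|^-1 *: x)|.
  by rewrite linearZ normrZ normfV normr_id.
by apply: opnorm_ub; rewrite normrZ normfV normr_id mulVf ?normr_eq0.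
Qed.

Lemma opnormD (f g : clinear) : opnorm (f + g) <= opnorm f + opnorm g.
Proof.
apply: opnorm_le => x x1; apply: le_trans (ler_normD _ _) _.
by apply: lerD; exact: opnorm_ub.
Qed.

Lemma opnormZ_le (a : R[i]) (f : clinear) :
  opnorm (a *: f) <= `|a| * opnorm f.
Proof.
apply: opnorm_le => x x1; have -> : (a *: f) x = a *: f x by [].
by rewrite normrZ ler_wpM2l// opnorm_ub.
Qed.

Lemma opnorm_eq0 (f : clinear) : opnorm f = 0 -> f = 0.
Proof.
move=> f0; apply/val_inj/funext => x; apply/eqP; rewrite -normr_le0.
by have := le_opnorm f x; rewrite f0 mul0r.
Qed.

Lemma opnormZ (a : R[i]) (f : clinear) : opnorm (a *: f) = `|a| * opnorm f.
Proof.
apply/le_anti; rewrite opnormZ_le/=.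
have [->|a0] := eqVneq a 0; first by rewrite normr0 mul0r opnorm_ge0.
rewrite -ler_pdivlMl ?normr_gt0// -normfV.
by rewrite -[f in leLHS](scalerK a0) opnormZ_le.
Qed.

HB.instance Definition _ :=
  Lmodule_isNormed.Build R[i] clinear opnormD opnormZ opnorm_eq0.

Lemma clinear_normE (f : clinear) : `|f| = opnorm f.
Proof. by []. Qed.

Lemma clinearP (f : {linear U -> W}) : continuous f ->
  (f : U -> W) \in is_clinear.
Proof. by move=> cf; rewrite inE; split => //; exact: linearP. Qed.

End ContinuousLinear.

Section Adjoint.
Variables (R : realType).

Definition dual (X : normedModType R[i]) := clinear X R[i]^o.
HB.instance Definition _ (X : normedModType R[i]) :=
  NormedModule.on (dual X).

Variables (U W : normedModType R[i]).

Lemma comp_is_clinear (T : clinear U W) (g : dual W) :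
  (g \o T : U -> R[i]^o) \in @is_clinear R U R[i]^o.
Proof.
rewrite inE; split; first by move=> a x y /=; rewrite !linearP.
by move=> x; apply: continuous_comp; exact: clinear_continuous.
Qed.

Definition adjoint_fun (T : clinear U W) (g : dual W) : dual U :=
  CLinear (comp_is_clinear T g).

Lemma adjoint_is_clinear (T : clinear U W) :
  adjoint_fun T \in @is_clinear R (dual W) (dual U).
Proof.
have lT : linear (adjoint_fun T) by move=> a f g; exact/val_inj.
pose L := GRing.isLinear.Build _ _ _ _ (adjoint_fun T) lT.
pose F : {linear dual W -> dual U} := HB.pack (adjoint_fun T) L.
apply: (@clinearP _ _ _ F).
apply/linear_bounded_continuous/bounded_funP => r.
exists (r * `|T|) => f fr; apply: opnorm_le => x x1.
apply: le_trans (le_opnorm f _) _; apply: ler_pM => //; first exact: opnorm_ge0.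
exact: opnorm_ub.
Qed.

Definition adjoint (T : clinear U W) : clinear (dual W) (dual U) :=
  CLinear (adjoint_is_clinear T).

End Adjoint.

Section Geometry.
Variables (R : realType) (X : normedModType R[i]).
Implicit Types (x y : X) (A Y Z : set X).

Definition is_subspace A :=
  A 0 /\ forall (a : R[i]) x y, A x -> A y -> A (a *: x + y).

Definition unit_sphere A : set X := [set x | A x /\ `|x| = 1].

Definition reflexive_space :=
  forall phi : dual (dual X), exists x, forall f : dual X, phi f = f x.

Definition strictly_convex :=
  forall x y, `|x| = 1 -> `|y| = 1 -> x != y -> `|2^-1 *: (x + y)| < 1.

Definition support_functional x (f : dual X) :=
  `|f| = `|x| /\ f x = `|x| ^+ 2.

Definition smooth := forall x, x != 0 -> exists! f, support_functional x f.

(* On smooth spaces this picks the only support functional; [x = 0] is no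
   exception since [`|f| = 0] forces [f = 0]. *)
Definition duality_map x : dual X := xget 0 [set f | support_functional x f].

Definition BJ_orthogonal x y := forall a : R[i], `|x| <= `|x + a *: y|.

Definition right_complemented Y :=
  [/\ is_subspace Y, closed Y &
   exists Z, [/\ is_subspace Z, closed Z,
     Y `&` Z = [set 0],
     (forall x, exists y z, [/\ Y y, Z z & x = y + z]) &
     forall y z, Y y -> Z z -> BJ_orthogonal y z]].

End Geometry.

Definition norm_attainment (R : realType) (U W : normedModType R[i])
    (T : clinear U W) : set U :=
  [set x | unit_sphere setT x /\ `|T x| = `|T|].

Section Isometry.
Variables (R : realType) (X : normedModType R[i]).

Lemma isometry_is_clinear (V : {linear X -> X}) :
  (forall x, `|V x| = `|x|) -> (V : X -> X) \in @is_clinear R X X.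
Proof.
move=> hV; apply: clinearP; apply/linear_bounded_continuous/bounded_funP => r.
by exists r => x; rewrite hV.
Qed.

Definition isometry_clinear (V : {linear X -> X})
    (hV : forall x, `|V x| = `|x|) : clinear X X :=
  CLinear (isometry_is_clinear hV).

Variables (V : {linear X -> X}) (hV : forall x, `|V x| = `|x|).

Definition duality_range : set (dual X) :=
  [set duality_map y | y in range V].

(* The inverse of the restriction of the adjoint to [duality_range], which is a
   bijection onto [dual X] when [X] is reflexive, smooth and strictly convex. *)
Definition Phi_inv : dual X -> dual X :=
  'pinv_(fun=> 0) duality_range (adjoint (isometry_clinear hV)).

End Isometry.

(* Main.v *)
(** Smoothness makes [f = f_x] provable by checking [`|f| <= `|x|] and
    [f x = `|x| ^+ 2].  Hence [V^\times] maps [f_{Vx}] to [f_x], and the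
    functionals whose norm [V^\times] preserves are exactly the [f_{Vx}].

    (i) => (ii): W is the annihilator of the complement of [V(X)]; composing
    [f_{Vx}] with the norm-one projection onto [V(X)] gives a support functional
    at [Vx] again, hence [f_{Vx}] itself.
    (ii) => (iii): [V^\times] is isometric on W, which contains every [f_{Vx}].
    (iii) => (iv): if [f_x + f_y = f_z] then [f_{Vx} + f_{Vy}] supports [Vz].
    (iv) => (i): by reflexivity the linear isometry [Phi^{-1}] is the adjoint of
    a contraction S with [S V = id]; the complement is the kernel of S.

    The duality map is onto because every functional f attains its norm: the
    limit along an ultrafilter of the evaluations at a maximizing sequence is a
    functional on the dual, represented by a point of the space by reflexivity.
    This replaces the Hahn-Banach theorem. *)

Require Import Defs.
From HB Require Import structures.
From mathcomp Require Import all_boot all_order all_algebra.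
From mathcomp Require Import complex.
From mathcomp Require Import all_classical all_reals all_analysis.
From mathcomp Require Import ring.

Set Implicit Arguments.
Unset Strict Implicit.
Unset Printing Implicit Defensive.

Import Order.TTheory GRing.Theory Num.Theory.
Import numFieldNormedType.Exports.

Local Open Scope classical_set_scope.
Local Open Scope ring_scope.
Local Open Scope complex_scope.

(** * Ultrafilter limits and bounded linear maps *)

(** Compactness of the segment gives a cluster point, and the image of an ultrafilter converges to
    each of its cluster points. *)
Lemma ultra_bounded_cvg (R : realType) (T : Type) (G : set_system T)
    (u : T -> R) (M : R) :
  UltraFilter G -> (forall t, `|u t| <= M) -> cvg (u @ G).
Proof.
move=> GU uM; have uGM : (u @ G) [set` `[- M, M]].
  by apply: (@filterE _ G) => t; rewrite /= in_itv/= -ler_norml; exact: uM.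
have [p [_ clp]] :=
  @segment_compact R (- M) M (u @ G) (fmap_proper_filter _ _) uGM.
apply/cvg_ex; exists p => A /= pA.
have [//|GnA] := in_ultra_setVsetC (u @^-1` A) GU.
by have [x []] := clp (~` A) A GnA pA.
Qed.

Lemma ultra_bounded_lim (R : realType) (T : Type) (G : set_system T)
    (u : T -> R) (M : R) :
  UltraFilter G -> (forall t, `|u t| <= M) -> `|lim (u @ G)| <= M.
Proof.
move=> GU uM; have cu := ultra_bounded_cvg GU uM.
have uMM t : - M <= u t <= M by rewrite -ler_norml; exact: uM.
rewrite ler_norml limr_ge ?limr_le//.
  by apply: nearW => t; have /andP[] := uMM t.
by apply: nearW => t; have /andP[] := uMM t.
Qed.

Lemma bounded_is_clinear (R : realType) (U W : normedModType R[i])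
    (f : U -> W) (M : R[i]) :
  0 <= M -> linear f -> (forall x, `|f x| <= M * `|x|) -> f \in @is_clinear R U W.
Proof.
move=> M0 lf fM; pose L := GRing.isLinear.Build _ _ _ _ f lf.
pose F : {linear U -> W} := HB.pack f L.
apply: (@clinearP _ _ _ F); apply/linear_bounded_continuous/bounded_funP => r.
by exists (M * r) => x xr; apply: le_trans (fM x) _; rewrite ler_wpM2l.
Qed.

Lemma ReM (R : realType) (a b : R[i]) :
  complex.Re (a * b) = complex.Re a * complex.Re b - complex.Im a * complex.Im b.
Proof. by case: a b => [a a'] [b b']. Qed.

Lemma ImM (R : realType) (a b : R[i]) :
  complex.Im (a * b) = complex.Re a * complex.Im b + complex.Im a * complex.Re b.
Proof. by case: a b => [a a'] [b b']. Qed.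

Lemma ReD (R : realType) (a b : R[i]) :
  complex.Re (a + b) = complex.Re a + complex.Re b.
Proof. by case: a b => [a a'] [b b']. Qed.

Lemma ImD (R : realType) (a b : R[i]) :
  complex.Im (a + b) = complex.Im a + complex.Im b.
Proof. by case: a b => [a a'] [b b']. Qed.

Lemma normRe_le (R : realType) (a : R[i]) : `|complex.Re a| <= complex.Re `|a|.
Proof. by have := normc_ge_Re a; rewrite lecE => /andP[]. Qed.

Lemma normC_real (R : realType) (r : R) : `|r%:C| = `|r|%:C.
Proof. by rewrite normc_def/= expr0n/= addr0 sqrtr_sqr. Qed.

Lemma normC_i (R : realType) : `|'i%C : R[i]| = 1.
Proof. by rewrite normc_def/= expr0n/= add0r expr1n sqrtr1. Qed.

Lemma normIm_le (R : realType) (a : R[i]) : `|complex.Im a| <= complex.Re `|a|.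
Proof.
rewrite -normrN -ReiNIm; apply: le_trans (normRe_le _) _.
by rewrite normrM normC_i mulr1.
Qed.

Lemma Re_le (R : realType) (a b : R[i]) : a <= b -> complex.Re a <= complex.Re b.
Proof. by rewrite lecE => /andP[]. Qed.

(** * Norming functionals in the bidual *)

Lemma dual_maximizing_seq (R : realType) (X : normedModType R[i]) (f : dual X) :
  exists u : nat -> X, [/\ forall n, `|u n| <= 1, forall n, f (u n) = `|f (u n)|
    & complex.Re (f (u n)) @[n --> \oo] --> complex.Re `|f|].
Proof.
have /choice[u uP] : forall n, exists x : X, [/\ `|x| <= 1, f x = `|f x|
    & complex.Re `|f| - n.+1%:R^-1 < complex.Re `|f x|].
  move=> n.
  have n0 : (0 : R) < n.+1%:R^-1 by rewrite invr_gt0.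
  have [_ [x x1 <-] xn] := sup_adherent n0 (opnorm_has_sup f).
  (* A near-maximizer is rotated by a phase so that [f] becomes real and nonnegative there. If
     [f x = 0], the convention [0^-1 = 0] makes the witness [0]. *)
  exists ((`|f x| / f x) *: x).
  have [fx0|fx0] := eqVneq (f x) 0.
    rewrite fx0 invr0 mulr0 scale0r linear0 !normr0; split => //.
    by move: xn; rewrite fx0 normr0.
  have a1 : `| `|f x| / f x | = 1.
    by rewrite normrM normfV normr_id divff ?normr_eq0.
  have fax : f ((`|f x| / f x) *: x) = `|f x|.
    rewrite linearZ/=; change (`|f x| / f x * f x = `|f x|).
    by rewrite divfK.
  by rewrite fax normr_id normrZ a1 mul1r.
exists u; split => [n|n|]; try by case: (uP n).
have hle n : complex.Re (f (u n)) <= complex.Re `|f|.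
  have [u1 -> _] := uP n; apply: Re_le; exact: opnorm_ub.
apply: (@squeeze_cvgr _ _ _ _ (fun n => complex.Re `|f| - n.+1%:R^-1)
  (fun=> complex.Re `|f|)).
- by apply: nearW => n; rewrite hle andbT; have [_ fu /ltW] := uP n; rewrite -fu.
- rewrite -[X in _ --> X]subr0; apply: cvgB; first exact: cvg_cst.
  exact: cvg_harmonic.
- exact: cvg_cst.
Qed.

Lemma bidual_norming (R : realType) (X : normedModType R[i]) (f : dual X) :
  exists phi : dual (dual X), phi f = `|f| /\
    forall g : dual X, complex.Re (phi g) <= complex.Re `|g|.
Proof.
have [u [u1 fu cfu]] := dual_maximizing_seq f.
(* A single ultrafilter finer than the filter at infinity makes the evaluations of all functionals
   converge at once, so the limit is linear. *)
have [G [GU ooG]] := @ultraFilterLemma nat \oo _.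
have ub (g : dual X) n : `|g (u n)| <= `|g| by apply: opnorm_ub.
have Reu (g : dual X) n : `|complex.Re (g (u n))| <= complex.Re `|g|.
  exact: le_trans (normRe_le _) (Re_le (ub g n)).
have Imu (g : dual X) n : `|complex.Im (g (u n))| <= complex.Re `|g|.
  exact: le_trans (normIm_le _) (Re_le (ub g n)).
pose re (g : dual X) := lim (complex.Re (g (u n)) @[n --> G]).
pose im (g : dual X) := lim (complex.Im (g (u n)) @[n --> G]).
pose phi (g : dual X) : R[i]^o := (re g +i* im g)%C.
have cRe g := ultra_bounded_cvg GU (Reu g).
have cIm g := ultra_bounded_cvg GU (Imu g).
have rele g : `|re g| <= complex.Re `|g| := ultra_bounded_lim GU (Reu g).
have imle g : `|im g| <= complex.Re `|g| := ultra_bounded_lim GU (Imu g).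
have lphi : linear phi.
  move=> a g h; apply/eqP; rewrite eq_complex; apply/andP; split; apply/eqP.
    change (re (a *: g + h) = complex.Re (a * phi g + phi h)).
    rewrite ReD ReM /=; apply/cvg_lim => //.
    under eq_fun do rewrite [X in complex.Re X]/= ReD ReM.
    apply: cvgD; last exact: cRe.
    by apply: cvgB; apply: cvgMr; [exact: cRe|exact: cIm].
  change (im (a *: g + h) = complex.Im (a * phi g + phi h)).
  rewrite ImD ImM /=; apply/cvg_lim => //.
  under eq_fun do rewrite [X in complex.Im X]/= ImD ImM.
  apply: cvgD; last exact: cIm.
  by apply: cvgD; apply: cvgMr; [exact: cIm|exact: cRe].
(* The crude constant 2, one for each of the real and imaginary parts, serves only for
   continuity. *)
have bphi (g : dual X) : `|phi g| <= 2 * `|g|.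
  have C2 (r : R) : `|r| <= complex.Re `|g| -> `|r%:C| <= `|g|.
    by move=> rg; rewrite normC_real -[leRHS]Re_normK lecR.
  rewrite (complexE (phi g)); apply: le_trans (ler_normD _ _) _.
  rewrite mulr2n mulrDl mul1r; apply: lerD; first exact: C2 (rele g).
  by rewrite normrM normC_i mul1r; exact: C2 (imle g).
have phiC := @bounded_is_clinear _ (dual X) _ phi 2 (ler0n _ _) lphi bphi.
exists (CLinear phiC); split.
  change (phi f = `|f|); rewrite -Re_normK /phi; congr (_ +i* _)%C.
    apply/cvg_lim => //; apply: cvg_trans cfu; exact: cvg_app.
  apply/cvg_lim => //.
  under eq_fun do rewrite fu -Re_normK /=.
  exact: cvg_cst.
by move=> g; apply: le_trans (ler_norm _) (rele g).
Qed.

(** * The duality map of a smooth space *)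

Section DualityMap.
Variables (R : realType) (X : normedModType R[i]).
Hypothesis hsmooth : smooth X.
Implicit Types (x y : X) (f g : dual X).

(** Evaluation at [x] gives the reverse bound: [|x|^2 = |f x| <= |f| |x|]. *)
Lemma support_functional_le x f :
  `|f| <= `|x| -> f x = `|x| ^+ 2 -> support_functional x f.
Proof.
move=> fx fxx; split => //; apply/le_anti; rewrite fx/=.
have [->|x0] := eqVneq x 0; first by rewrite normr0.
have := le_opnorm f x; rewrite fxx normrX normr_id expr2.
by rewrite ler_pM2r ?normr_gt0.
Qed.

Lemma duality_mapP x : support_functional x (duality_map x).
Proof.
apply: (@xgetPex _ _ [set f | support_functional x f]).
have [->|x0] := eqVneq x 0.
  by exists 0; split; rewrite ?normr0 ?expr0n//= linear0.
by have [f [fS _]] := hsmooth x0; exists f.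
Qed.

Lemma norm_duality_map x : `|duality_map x| = `|x|.
Proof. by have [] := duality_mapP x. Qed.

Lemma duality_map_self x : duality_map x x = `|x| ^+ 2.
Proof. by have [] := duality_mapP x. Qed.

Lemma duality_map_eq x f : support_functional x f -> f = duality_map x.
Proof.
have [->|x0] := eqVneq x 0.
  move=> [/eqP + _]; rewrite normr0 normr_eq0 => /eqP ->.
  by apply/esym/eqP; rewrite -normr_eq0 norm_duality_map normr0.
have [g [_ gu]] := hsmooth x0.
by move=> /gu <-; exact: gu (duality_mapP x).
Qed.

Lemma duality_mapZ (a : R[i]) x : duality_map (a *: x) = a^* *: duality_map x.
Proof.
apply/esym/duality_map_eq; split.
  by rewrite !normrZ norm_conjC norm_duality_map.
change (a^* * duality_map x (a *: x) = `|a *: x| ^+ 2).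
rewrite linearZ; change (a^* * (a * duality_map x x) = `|a *: x| ^+ 2).
by rewrite duality_map_self normrZ exprMn normCKC mulrA.
Qed.

(** The support functional of [x - y] takes the value [|x - y|^2] there. *)
Lemma dual_separated x y : (forall f, f x = f y) -> x = y.
Proof.
move=> xy; apply/eqP; rewrite -subr_eq0 -normr_eq0 -sqrf_eq0.
by rewrite -duality_map_self linearB/= xy subrr.
Qed.

(** The point [x] representing the norming element of the bidual satisfies [f x = |f|]. Testing that
    element on [f_x] gives [|x|^2 <= |x|], so [x] lies in the unit ball and [|f| x] is supported by
    [f]. *)
Lemma duality_map_surj : reflexive_space X -> forall f, exists x, f = duality_map x.
Proof.
move=> hrefl f; have [phi [phif phib]] := bidual_norming f.
have [x phix] := hrefl phi.
have x1 : `|x| <= 1.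
  have [->|x0] := eqVneq x 0; first by rewrite normr0.
  have := phib (duality_map x); rewrite phix duality_map_self norm_duality_map.
  by rewrite -lecR !RRe_real ?rpredX ?normr_real// expr2 ger_pMr ?normr_gt0.
exists (`|f| *: x); apply: duality_map_eq; apply/and_comm.
have fy : f (`|f| *: x) = `|f| ^+ 2.
  rewrite linearZ; change (`|f| * f x = `|f| ^+ 2).
  by rewrite -phix phif.
have ny : `| `|f| *: x| = `|f|.
  apply/le_anti; rewrite normrZ normr_id ler_piMr//=.
  have [f0|f0] := eqVneq f 0; first by rewrite f0 normr0 mul0r.
  have := le_opnorm f (`|f| *: x); rewrite fy normrX normr_id expr2.
  by rewrite normrZ normr_id ler_pM2l // normr_gt0.
by rewrite /support_functional ny.
Qed.

(** A common support functional of [x] and [y] has norm [|x|] and takes the value [|x|] at the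
    midpoint of the normalized vectors. By strict convexity that midpoint has norm below 1 unless
    [x = y]. *)
Lemma duality_map_inj : strictly_convex X -> injective (@duality_map R X).
Proof.
move=> hconvex x y xy; have nxy : `|y| = `|x| by rewrite -!norm_duality_map xy.
have [x0|x0] := eqVneq x 0.
  by apply/eqP; rewrite x0 eq_sym -normr_eq0 nxy x0 normr0.
have xgt0 : 0 < `|x| by rewrite normr_gt0.
apply/eqP/negP => /negP xNy.
pose m := 2^-1 *: (`|x|^-1 *: x + `|x|^-1 *: y).
have m1 : `|m| < 1.
  apply: hconvex; rewrite ?normrZ ?normfV ?normr_id ?nxy ?mulVf ?gt_eqF//.
  by rewrite (inj_eq (scalerI _)) ?invr_eq0 ?gt_eqF.
have fm : duality_map x m = `|x|.
  rewrite /m -scalerDr !linearZ linearD/= {2}xy !duality_map_self nxy.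
  change (2^-1 * (`|x|^-1 * (`|x| ^+ 2 + `|x| ^+ 2)) = `|x|).
  by field; rewrite gt_eqF.
have := le_opnorm (duality_map x) m.
rewrite fm normr_id [opnorm _]norm_duality_map.
by rewrite -[leLHS]mulr1 ler_pM2l// => /le_lt_trans/(_ m1); rewrite ltxx.
Qed.

End DualityMap.

(** * The adjoint of an isometry on support functionals *)

Section IsometryAdjoint.
Variables (R : realType) (X : normedModType R[i]).
Hypotheses (hrefl : reflexive_space X) (hsmooth : smooth X).
Hypothesis hconvex : strictly_convex X.
Variables (V : {linear X -> X}) (hV : forall x : X, `|V x| = `|x|).
Implicit Types (x y : X) (f g : dual X).

Let V' : clinear (dual X) (dual X) := adjoint (isometry_clinear hV).
Let J : X -> dual X := @duality_map R X.

Lemma adjoint_duality_map x : V' (J (V x)) = J x.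
Proof.
apply: duality_map_eq => //; apply: support_functional_le.
  apply: opnorm_le => y y1; change (`|J (V x) (V y)| <= `|x|).
  apply: le_trans (le_opnorm _ _) _.
  by rewrite [opnorm _]norm_duality_map// !hV ler_piMr.
change (J (V x) (V x) = `|x| ^+ 2).
by rewrite duality_map_self// hV.
Qed.

Lemma norm_adjoint_le f : `|V' f| <= `|f|.
Proof.
apply: opnorm_le => y y1; change (`|f (V y)| <= `|f|).
by apply: opnorm_ub; rewrite hV.
Qed.

(** Write [V' f = f_x] by surjectivity of the duality map. Then [f (V x) = |x|^2], and preservation
    of the norm makes [f] a support functional at [V x]. *)
Lemma norm_adjoint_eqP f : `|V' f| = `|f| <-> exists x, f = J (V x).
Proof.
split=> [V'f|[x ->]]; last by rewrite adjoint_duality_map !norm_duality_map.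
have [x V'fx] := duality_map_surj hsmooth hrefl (V' f).
exists x; apply: duality_map_eq => //; split.
  by rewrite hV -V'f V'fx norm_duality_map.
by change (V' f x = `|V x| ^+ 2); rewrite V'fx duality_map_self// hV.
Qed.

Lemma norm_adjoint_isometry x : x != 0 -> `|V'| = 1.
Proof.
move=> x0; apply/le_anti/andP; split.
  apply: opnorm_le => f f1; exact: le_trans (norm_adjoint_le f) f1.
have := le_opnorm V' (J (V x)).
rewrite adjoint_duality_map !norm_duality_map// hV.
by rewrite -[leLHS]mul1r ler_pM2r ?normr_gt0.
Qed.

Lemma Phi_inv_duality_map x : Phi_inv hV (J x) = J (V x).
Proof.
(* On the [f_{Vx}] the adjoint acts as [f_{Vx} -> f_x], so injectivity of the duality map recovers
   [x], and the partial inverse is a genuine one. *)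
have inj : {in duality_range V &, injective V'}.
  move=> _ _ /set_mem[_ [y _ <-] <-] /set_mem[_ [z _ <-] <-].
  rewrite !adjoint_duality_map => yz.
  by rewrite (duality_map_inj hsmooth hconvex yz).
rewrite -[in LHS](adjoint_duality_map x) /Phi_inv pinvKV //.
by rewrite inE; exists (V x) => //; exists x.
Qed.
End IsometryAdjoint.

(** The projection along [Z] is contractive by orthogonality with scalar 1:
    [|P x| <= |P x + (x - P x)|]. *)
Lemma right_complement_projection (R : realType) (X : normedModType R[i])
    (Y Z : set X) : is_subspace Y -> is_subspace Z -> Y `&` Z = [set 0] ->
  (forall x, exists y z, [/\ Y y, Z z & x = y + z]) ->
  (forall y z, Y y -> Z z -> BJ_orthogonal y z) ->
  exists P : {linear X -> X}, [/\ forall x, Y (P x), forall x, Z (x - P x),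
    forall y, Y y -> P y = y, forall z, Z z -> P z = 0 & forall x, `|P x| <= `|x|].
Proof.
move=> [Y0 YL] [Z0 ZL] YZ0 YZ YbZ.
have /choice[P PP] x : exists p, Y p /\ Z (x - p).
  by have [y [z [Yy Zz ->]]] := YZ x; exists y; rewrite addrC addKr.
have uniqP x p : Y p -> Z (x - p) -> P x = p.
  move=> Yp Zxp; have [YPx ZxPx] := PP x; apply/eqP; rewrite -subr_eq0; apply/eqP.
  suff : (Y `&` Z) (P x - p) by rewrite YZ0.
  split; first by rewrite addrC -scaleN1r; exact: YL.
  have -> : P x - p = -1 *: (x - P x) + (x - p).
    by rewrite scaleN1r opprB subrKA.
  exact: ZL.
have lP : linear P.
  move=> a x y; have [[Yx Zx] [Yy Zy]] := (PP x, PP y).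
  apply: uniqP; first exact: YL.
  have -> : a *: x + y - (a *: P x + P y) = a *: (x - P x) + (y - P y).
    by rewrite opprD addrACA scalerBr.
  exact: ZL.
pose L := GRing.isLinear.Build _ _ _ _ P lP.
pose F : {linear X -> X} := HB.pack P L.
exists F; split=> [x|x|y Yy|z Zz|x]; try by case: (PP x).
- by apply: uniqP => //; rewrite subrr.
- by apply: uniqP => //; rewrite subr0.
have [YPx ZxPx] := PP x.
by have := YbZ _ _ YPx ZxPx 1; rewrite scale1r addrC subrK.
Qed.

(** * The cycle of implications *)

Section Equivalences.
Variables (R : realType) (X : normedModType R[i]).
Hypotheses (hrefl : reflexive_space X) (hsmooth : smooth X).
Hypothesis hconvex : strictly_convex X.
Variables (V : {linear X -> X}) (hV : forall x : X, `|V x| = `|x|).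
Implicit Types (x y : X) (f g : dual X).

Let V' : clinear (dual X) (dual X) := adjoint (isometry_clinear hV).
Let J : X -> dual X := @duality_map R X.

Lemma range_subspace : is_subspace (range V).
Proof.
split; first by exists 0; rewrite ?linear0.
by move=> a _ _ [x _ <-] [y _ <-]; exists (a *: x + y); rewrite ?linearP.
Qed.

(** As [V'] has norm 1, a unit vector attains it exactly when [V'] preserves its norm. The nonzero
    vector [x0] ensures that the norm is not 0. *)
Lemma norm_attainment_adjointE x0 : x0 != 0 ->
  norm_attainment V' = unit_sphere [set f | exists x, f = J (V x)].
Proof.
move=> x0_neq0; have V'1 := norm_adjoint_isometry hsmooth hV x0_neq0.
have aP f := norm_adjoint_eqP hrefl hsmooth hV f.
apply/seteqP; split=> f /=.
  move=> [[_ f1]]; rewrite V'1 => V'f; split => //.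
  by apply/aP; rewrite V'f.
by move=> [/aP V'f f1]; split; rewrite ?V'1 ?V'f.
Qed.

(** The functional [f_y] composed with [P] again supports [y], so it equals [f_y] by smoothness and
    vanishes where [P] does. *)
Lemma duality_map_right_complement (P : {linear X -> X}) y z :
  (forall x, `|P x| <= `|x|) -> P y = y -> P z = 0 -> J y z = 0.
Proof.
move=> Pn Py Pz.
have PJn x : `|J y (P x)| <= `|J y| * `|x|.
  apply: le_trans (le_opnorm _ _) _.
  exact: (ler_wpM2l (normr_ge0 (J y)) (Pn x)).
have lPJ : linear (fun x => J y (P x) : R[i]^o) by move=> a u v; rewrite !linearP.
pose g : dual X := CLinear (bounded_is_clinear (normr_ge0 _) lPJ PJn).
suff <- : g = J y by change (J y (P z) = 0); rewrite Pz linear0.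
apply: duality_map_eq => //; apply: support_functional_le.
  apply: opnorm_le => x x1; apply: le_trans (PJn x) _.
  by rewrite norm_duality_map// ler_piMr.
by change (J y (P y) = `|y| ^+ 2); rewrite Py duality_map_self.
Qed.

Lemma right_complemented_norm_attainment x0 : x0 != 0 ->
  right_complemented (range V) ->
  exists W : set (dual X), is_subspace W /\ norm_attainment V' = unit_sphere W.
Proof.
move=> x0_neq0 [sV _ [Z [sZ _ VZ0 VZ VbZ]]].
have [P [PV PZ Py Pz Pn]] := right_complement_projection sV sZ VZ0 VZ VbZ.
exists [set f : dual X | forall z, Z z -> f z = 0]; split.
  split=> [z _ //|a f g Wf Wg z Zz].
  by change (a * f z + g z = 0); rewrite Wf// Wg// mulr0 addr0.
rewrite (norm_attainment_adjointE x0_neq0); congr unit_sphere.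
apply/seteqP; split=> [f /= [x ->] z Zz|f /= Wf].
  apply: (duality_map_right_complement Pn); last exact: Pz.
  by apply: Py; exists x.
(* Conversely, if [f] kills [Z] and [P u = V w], then [f u = f (V w) = V' f w] with
   [|w| = |P u| <= |u|], whence [|f| <= |V' f|]. *)
apply/(norm_adjoint_eqP hrefl hsmooth hV)/le_anti; rewrite norm_adjoint_le/=.
apply: opnorm_le => u u1.
have [w _ Vw] := PV u.
have -> : f u = f (P u).
  by apply/subr0_eq; rewrite -linearB; exact: Wf.
rewrite -Vw; apply: (@opnorm_ub _ _ _ (V' f)).
by rewrite -hV Vw (le_trans (Pn u)).
Qed.

Lemma norm_attainment_duality_map_norm x0 : x0 != 0 ->
  (exists W : set (dual X), is_subspace W /\ norm_attainment V' = unit_sphere W) ->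
  forall x y, `|J x + J y| = `|J (V x) + J (V y)|.
Proof.
move=> x0_neq0 [W [[W0 WL] MW]] x y.
have WZ (a : R[i]) f : W f -> W (a *: f).
  by move=> Wf; rewrite -[_ *: _]addr0; exact: WL.
(* Only unit functionals are known to lie in [W]; conjugate homogeneity of the duality map extends
   this to every [f_{Vu}]. *)
have WJ u : W (J (V u)).
  have [->|u0] := eqVneq u 0.
    suff -> : J (V 0) = 0 by [].
    by apply/eqP; rewrite -normr_eq0 norm_duality_map// hV normr0.
  pose e := `|u|^-1 *: u.
  have e1 : `|e| = 1 by rewrite normrZ normfV normr_id mulVf ?normr_eq0.
  have : unit_sphere W (J (V e)).
    rewrite -MW (norm_attainment_adjointE x0_neq0); split; first by exists e.
    by rewrite norm_duality_map// hV.
  have -> : u = `|u| *: e by rewrite scalerA divff ?normr_eq0// scale1r.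
  by move=> [We _]; rewrite linearZ /J duality_mapZ//; exact: WZ.
have Wn f : W f -> `|V' f| = `|f|.
  move=> Wf; have [->|f0] := eqVneq f 0; first by rewrite linear0 !normr0.
  have : unit_sphere W (`|f|^-1 *: f).
    split; first exact: WZ.
    by rewrite normrZ normfV normr_id mulVf ?normr_eq0.
  rewrite -MW => -[_]; rewrite (norm_adjoint_isometry hsmooth hV x0_neq0).
  rewrite linearZ/= normrZ normfV normr_id => /(congr1 (fun t => `|f| * t)).
  by rewrite mulVKf ?normr_eq0// mulr1.
have <- : V' (J (V x) + J (V y)) = J x + J y.
  by rewrite linearD; congr (_ + _); exact: adjoint_duality_map.
by apply: Wn; rewrite -[J (V x)]scale1r; exact: WL.
Qed.

Lemma duality_map_norm_linear_Phi_inv :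
  (forall x y, `|J x + J y| = `|J (V x) + J (V y)|) -> linear (Phi_inv hV).
Proof.
move=> nJ a f g; have PJ u := Phi_inv_duality_map hsmooth hconvex hV u.
have [x ->] := duality_map_surj hsmooth hrefl f.
have [y ->] := duality_map_surj hsmooth hrefl g.
have aJ u : a *: J u = J (a^* *: u) by rewrite /J duality_mapZ// conjCK.
(* The scalar is absorbed, conjugated, into [x], so only additivity remains. *)
rewrite !PJ !aJ -linearZ/=; move: (a^* *: x) => {}x.
have [z xyz] := duality_map_surj hsmooth hrefl (J x + J y).
rewrite xyz PJ; apply/esym/duality_map_eq => //; split.
  by rewrite -nJ xyz norm_duality_map// hV.
change (J (V x) (V z) + J (V y) (V z) = `|V z| ^+ 2).
change (V' (J (V x)) z + V' (J (V y)) z = `|V z| ^+ 2).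
rewrite !adjoint_duality_map// hV -duality_map_self// -xyz //.
Qed.

(** For fixed [x], the map [f -> Phi_inv f x] is a bounded functional on the dual; reflexivity
    represents it by the point [S x]. Testing on [f_{Sx}] shows that [S] is a contraction. *)
Lemma linear_Phi_inv_left_inverse : linear (Phi_inv hV) ->
  exists S : {linear X -> X}, (forall x, S (V x) = x) /\ forall x, `|S x| <= `|x|.
Proof.
move=> lPhi; have PJ u := Phi_inv_duality_map hsmooth hconvex hV u.
have nPhi f : `|Phi_inv hV f| = `|f|.
  have [x ->] := duality_map_surj hsmooth hrefl f.
  by rewrite PJ !norm_duality_map.
have /choice[S SP] x : exists s, forall f, f s = Phi_inv hV f x.
  have lphi : linear (fun f : dual X => Phi_inv hV f x : R[i]^o).
    by move=> a f g; rewrite lPhi.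
  have bphi f : `|Phi_inv hV f x : R[i]^o| <= `|x| * `|f|.
    by rewrite mulrC -nPhi; exact: le_opnorm.
  pose phi : dual (dual X) := CLinear (bounded_is_clinear (normr_ge0 _) lphi bphi).
  by have [s phis] := hrefl phi; exists s => f; rewrite -phis.
have lS : linear S.
  move=> a x y; apply: (dual_separated hsmooth) => f.
  by rewrite (clinear_is_linear f) !SP (clinear_is_linear (Phi_inv hV f)).
pose L := GRing.isLinear.Build _ _ _ _ S lS.
pose F : {linear X -> X} := HB.pack S L.
exists F; split=> x.
  apply: (dual_separated hsmooth) => f; rewrite [F _]/= SP.
  have [y ->] := duality_map_surj hsmooth hrefl f.
  rewrite PJ; change (V' (J (V y)) x = J y x).
  by rewrite /V' /J adjoint_duality_map.
rewrite [F _]/=; have [->|Sx0] := eqVneq (S x) 0; first by rewrite normr0.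
have := le_opnorm (Phi_inv hV (J (S x))) x.
rewrite -SP duality_map_self// normrX normr_id expr2 [opnorm _]nPhi.
by rewrite norm_duality_map// ler_pM2l ?normr_gt0.
Qed.

Lemma linear_Phi_inv_right_complemented :
  linear (Phi_inv hV) -> right_complemented (range V).
Proof.
move=> /linear_Phi_inv_left_inverse[S [SV Sn]].
have cS : continuous S.
  have Sn1 x : `|S x| <= 1 * `|x| by rewrite mul1r.
  have Sc := bounded_is_clinear ler01 (@linearP _ _ _ _ S) Sn1.
  exact: (@clinear_continuous _ _ _ (CLinear Sc)).
have cV : continuous V := @clinear_continuous _ _ _ (isometry_clinear hV).
have closed0 : closed [set 0 : X].
  exact/accessible_closed_set1/hausdorff_accessible/norm_hausdorff.
split; first exact: range_subspace.
  (* The range is the kernel of the continuous map [id - V S], hence closed. *)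
  have -> : range V = (fun x => x - V (S x)) @^-1` [set 0].
    apply/seteqP; split=> x /=; first by move=> [y _ <-]; rewrite SV subrr.
    by move=> /subr0_eq ->; exists (S x).
  apply: closed_comp => // x _.
  by apply: cvgB; [exact: cvg_id|apply: continuous_comp; [exact: cS|exact: cV]].
exists (S @^-1` [set 0]); split.
- split; first by rewrite /= linear0.
  by move=> a x y /= Sx Sy; rewrite linearP Sx Sy scaler0 addr0.
- exact: closed_comp.
- apply/seteqP; split=> x /=; last by move=> ->; split; [exists 0|]; rewrite ?linear0.
  by move=> [[y _ <-]]; rewrite SV => ->; rewrite linear0.
- move=> x; exists (V (S x)), (x - V (S x)); split.
  + by exists (S x).
  + by rewrite /= linearB SV subrr.
  + by rewrite addrC subrK.
move=> _ z [y _ <-] /= Sz a; rewrite hV.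
(* Orthogonality is contractivity of [S] at [V y + a z], whose image is [y]. *)
suff {1}<- : S (V y + a *: z) = y by exact: Sn.
by rewrite linearD linearZ/= Sz scaler0 addr0 SV.
Qed.

End Equivalences.

Theorem theorem5p6 (R : realType) (X : completeNormedModType R[i])
    (hrefl : reflexive_space X) (hsmooth : smooth X)
    (hconvex : strictly_convex X)
    (V : {linear X -> X}) (hV : forall x : X, `|V x| = `|x|)
    (hns : range V <> setT) :
  let V' := adjoint (isometry_clinear hV) in
  [<-> right_complemented (range V);
       exists W : set (dual X), is_subspace W /\ norm_attainment V' = unit_sphere W;
       forall x y : X,
         `|duality_map x + duality_map y| =
         `|duality_map (V x) + duality_map (V y)|;
       linear (Phi_inv hV)].
Proof.
(* On the zero space [V] would be surjective. *)
have [x0 x0_neq0] : exists x : X, x != 0.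
  apply: contrapT => noX; apply: hns; apply/seteqP; split=> // x _.
  exists x => //; suff x0 y : y = 0 :> X by rewrite (x0 (V x)) (x0 x).
  by apply: contrapT => /eqP y0; apply: noX; exists y.
move=> V'; tfae.
- exact: right_complemented_norm_attainment x0_neq0.
- exact: norm_attainment_duality_map_norm x0_neq0.
- exact: duality_map_norm_linear_Phi_inv.
- exact: linear_Phi_inv_right_complemented.
Qed.
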